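(* Consider vertex-weighted online bipartite matching with patience under known non-stationary (prophet) arrivals (defined in the context). Let $\kappa\in(0,1]$ and let $x^*$ be a feasible solution of the policy LP with finite support whose objective value is at least $\kappa\cdot\mathsf{OPT}_{\mathsf{LPP}}$. Then the expected total weight matched by the Sampling-Algorithm run with $x^*$ is at least $\kappa(1-1/e)\cdot\mathsf{OPT}_{\mathsf{LPP}}$; in particular it is $\kappa(1-1/e)$-competitive.
   Context: Offline vertices $U$ with weights $w_u\ge0$ (vertex weights: matching $u$ to any arrival earns $w_u$); a finite set $V$ of online types; edge probabilities $p_{uv}\in[0,1]$; each type $v$ has a patience model (a deterministic positive integer, or a random positive integer with known distribution revealed only when exhausted). There are $T$ time steps; at time $t$ an online vertex arrives whose type is $v$ with probability $q_{tv}$ ($\sum_v q_{tv}=1$), independently over $t$; $q_v:=\sum_t q_{tv}$. When a type-$v$ vertex arrives it may probe edges $(u,v)$ to unmatched offline vertices one at a time; an existing edge is matched irrevocably (reward $w_u$) and probing of this arrival stops; a failed probe counts against the patience and probing stops when patience is exhausted; all probing of an arrival happens before the next arrival. A policy $\pi$ is an ordered sequence of distinct offline vertices, followed by probing them in order until success, end of $\pi$, or exhaustion of patience; $\mathcal P$ is the set of policies and $p_{uv}(\pi)$ is the probability that a type-$v$ arrival following $\pi$ is matched to $u$ when all vertices of $\pi$ are unmatched. Policy LP: maximize $\sum_v\sum_\pi x_v(\pi)\sum_u p_{uv}(\pi)w_u$ subject to $\sum_v\sum_\pi x_v(\pi)p_{uv}(\pi)\le1$ for all $u$, $\sum_\pi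 x_v(\pi)=q_v$ for all $v$, $x_v(\pi)\ge0$; its optimal value $\mathsf{OPT}_{\mathsf{LPP}}$ upper-bounds the expected weight of an offline algorithm knowing realized arrival types in advance (competitive ratios are measured against it). Sampling-Algorithm: at each time $t$, when a type-$v$ vertex arrives, sample $\pi=(\pi_1,\dots,\pi_\ell)$ with probability $x^*_v(\pi)/q_v$; for $i=1,\dots,\ell$: if $\pi_i$ is unmatched, probe $(\pi_i,v)$ and match on success; otherwise perform a simulated probe (an independent coin with success probability $p_{\pi_i v}$; on success stop processing this arrival without matching; a simulated failure counts as a failed attempt against the patience, with exhaustion sampled by the algorithm from the conditional patience distribution when patience is random). *)

(* Defs.v *)
From mathcomp Require Import all_boot all_order all_algebra.
From mathcomp Require Import all_classical all_reals all_analysis.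

Set Implicit Arguments.
Unset Strict Implicit.
Unset Printing Implicit Defensive.

Import Order.TTheory GRing.Theory Num.Theory.

Local Open Scope classical_set_scope.
Local Open Scope ring_scope.

(* Discrete laws are represented by their mass functions. *)
Definition dist (R : realType) (A : finType) := A -> R.

Definition dret (R : realType) (A : finType) (a : A) : dist R A :=
  fun b => (a == b)%:R.

Definition dbind (R : realType) (A B : finType) (mu : dist R A)
    (f : A -> dist R B) : dist R B :=
  fun b => \sum_a mu a * f a b.

Definition dflip (R : realType) (a : R) : dist R bool :=
  fun b => if b then a else 1 - a.

Definition dprob (R : realType) (A : finType) (mu : dist R A) (E : pred A) : R :=
  \sum_(a | E a) mu a.

Definition dexp (R : realType) (A : finType) (mu : dist R A) (f : A -> R) : R :=
  \sum_a mu a * f a.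

(* [prob_edge u v] is p_{uv} and [arrival t v] is q_{tv}.  A deterministic
   patience l is the Dirac measure at l. *)
Record instance (R : realType) (U V : finType) (T : nat) := Instance {
  weight : U -> R;
  prob_edge : U -> V -> R;
  patience : V -> probability nat R;
  arrival : 'I_T -> V -> R;
  weight_ge0 : forall u, 0 <= weight u;
  prob_edge01 : forall u v, 0 <= prob_edge u v <= 1;
  patience_pos : forall v, patience v [set 0%N] = 0%E;
  arrival_ge0 : forall t v, 0 <= arrival t v;
  arrival_sum1 : forall t, \sum_v arrival t v = 1
}.

(* A duplicate-free sequence over U has length at most #|U|, so this finite
   type contains all of them, the empty one included. *)
Definition policy (U : finType) := {s : {bseq #|U| of U} | uniq s}.

Section Model.
Variables (R : realType) (U V : finType) (T : nat) (I : instance R U V T).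

Definition arrival_total (v : V) : R := \sum_t arrival I t v.

Definition matched_weight (M : {set U}) : R := \sum_(u in M) weight I u.

(* P[theta = j | theta >= j]: the probability that the patience of a type-v
   arrival is exhausted by its j-th failed attempt, given that it was not by
   the first j - 1.  (If P[theta >= j] = 0 this is 0, but then the j-th attempt
   is never made.) *)
Definition hazard (v : V) (j : nat) : R :=
  fine (patience I v [set j]) / fine (patience I v [set k | (j <= k)%N]).

(* Law of the set of matched offline vertices after processing a type-v arrival
   along the sequence s, when M is the set matched beforehand and the next
   attempt is the j-th one of this arrival.  The attempt on u is a real probe if
   u is unmatched and a simulated one otherwise; failures of both kinds count
   against the patience. *)
Fixpoint serve (v : V) (j : nat) (s : seq U) (M : {set U}) : dist R {set U} :=
  if s is u :: s' then
    dbind (dflip (prob_edge I u v)) (fun success : bool =>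
      if success then dret R (if u \notin M then u |: M else M)
      else dbind (dflip (hazard v j)) (fun exhausted : bool =>
        if exhausted then dret R M else serve v j.+1 s' M))
  else dret R M.

Definition follow (v : V) (s : policy U) (M : {set U}) : dist R {set U} :=
  serve v 1 (val (val s)) M.

(* p_{uv}(s) *)
Definition policy_match (u : U) (v : V) (s : policy U) : R :=
  dprob (follow v s finset.set0) (fun M : {set U} => u \in M).

Definition LPP_value (x : V -> policy U -> R) : R :=
  \sum_v \sum_s x v s * \sum_u policy_match u v s * weight I u.

Definition LPP_feasible (x : V -> policy U -> R) : Prop :=
  [/\ forall u, \sum_v \sum_s x v s * policy_match u v s <= 1,
      forall v, \sum_s x v s = arrival_total v
    & forall v s, 0 <= x v s].

(* The feasible region is non-empty and the objective is bounded on it, so this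
   is the genuine supremum. *)
Definition OPT_LPP : R :=
  sup [set LPP_value x | x in [set x | LPP_feasible x]].

(* If q_v = 0 then [x v _ / q_v] is not a probability law, but a type-v arrival
   has probability 0 in that case. *)
Definition sampling_step (x : V -> policy U -> R) (M : {set U}) (t : 'I_T) :
    dist R {set U} :=
  dbind (arrival I t : dist R V) (fun v =>
    dbind ((fun s => x v s / arrival_total v) : dist R (policy U)) (fun s =>
      follow v s M)).

Definition sampling_law (x : V -> policy U -> R) : dist R {set U} :=
  foldl (fun mu t => dbind mu (fun M => sampling_step x M t))
    (dret R finset.set0) (enum 'I_T).

Definition sampling_weight (x : V -> policy U -> R) : R :=
  dexp (sampling_law x) matched_weight.

(* Benchmark.  An adaptive, possibly randomized, probing strategy against a
   known sequence of T arrival types: [Probe t u a b c] probes the edge between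
   arrival t and u, and continues with a on success, with b on a failure which
   leaves patience, and with c on a failure which exhausts the patience of t.
   Arrivals may be handled in any order, and even be interleaved. *)
Inductive strategy : Type :=
| Stop
| Flip of R & strategy & strategy
| Probe of 'I_T & U & strategy & strategy & strategy.

(* M: matched offline vertices; C: arrivals which are matched or out of
   patience; F: probed non-existing edges. *)
Fixpoint admissible (S : strategy) (M : {set U}) (C : {set 'I_T})
    (F : {set 'I_T * U}) : bool :=
  match S with
  | Stop => true
  | Flip a S1 S2 =>
      [&& 0 <= a <= 1, admissible S1 M C F & admissible S2 M C F]
  | Probe t u Ssucc Sfail Sexh =>
      [&& u \notin M, t \notin C, (t, u) \notin F,
          admissible Ssucc (u |: M) (t |: C) F,
          admissible Sfail M C ((t, u) |: F)
        & admissible Sexh M (t |: C) ((t, u) |: F)]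
  end.

Fixpoint strategy_law (tau : 'I_T -> V) (S : strategy) (M : {set U})
    (F : {set 'I_T * U}) : dist R {set U} :=
  match S with
  | Stop => dret R M
  | Flip a S1 S2 =>
      dbind (dflip a) (fun b : bool =>
        if b then strategy_law tau S1 M F else strategy_law tau S2 M F)
  | Probe t u Ssucc Sfail Sexh =>
      dbind (dflip (prob_edge I u (tau t))) (fun success : bool =>
        if success then strategy_law tau Ssucc (u |: M) F
        else dbind
          (dflip (hazard (tau t) #|[set u' | (t, u') \in F]%SET|.+1))
          (fun exhausted : bool =>
            if exhausted then strategy_law tau Sexh M ((t, u) |: F)
            else strategy_law tau Sfail M ((t, u) |: F)))
  end.

(* An offline algorithm chooses its strategy knowing all realized types. *)
Definition offline_admissible (A : {ffun 'I_T -> V} -> strategy) : Prop :=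
  forall tau, admissible (A tau) finset.set0 finset.set0 finset.set0.

Definition offline_weight (A : {ffun 'I_T -> V} -> strategy) : R :=
  \sum_(tau : {ffun 'I_T -> V}) (\prod_t arrival I t (tau t)) *
    dexp (strategy_law tau (A tau) finset.set0 finset.set0) matched_weight.

(* An online algorithm of expected weight [alg] is c-competitive. *)
Definition competitive (c alg : R) : Prop :=
  forall A, offline_admissible A -> c * offline_weight A <= alg.

End Model.

(* Main.v *)
(* Because of the simulated probes, an unmatched u is matched at time t with a
   probability y_tu which does not depend on the other offline vertices, so u
   stays unmatched with probability prod_t (1 - y_tu) <= exp (- sum_t y_tu).
   The sum Y_u of the y_tu is the LP load of u, which is at most 1, and
   1 - exp (- Y_u) >= (1 - 1/e) Y_u on [0, 1] by convexity.

   For the offline benchmark, fix the realized types.  Seen from one arrival,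
   an adaptive interleaved strategy is a random policy, whose law is built by
   induction on the strategy.  Averaging these laws over the types gives a
   feasible LP solution with the same value. *)
Require Import Defs.
From mathcomp Require Import all_boot all_order all_algebra.
From mathcomp Require Import all_classical all_reals all_analysis.
From mathcomp Require Import ring lra.

Set Implicit Arguments.
Unset Strict Implicit.
Unset Printing Implicit Defensive.

Import Order.TTheory GRing.Theory Num.Theory.

Local Open Scope ring_scope.

Section Expectation.
Variable R : realType.

Lemma dexp_dret (A : finType) (a : A) (g : A -> R) : dexp (dret R a) g = g a.
Proof.
rewrite /dexp /dret (bigD1 a) //= eqxx mul1r big1 ?addr0 // => b /negPf.
by rewrite eq_sym => ->; rewrite mul0r.
Qed.

Lemma dexp_dbind (A B : finType) (mu : dist R A) (f : A -> dist R B)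
    (g : B -> R) : dexp (dbind mu f) g = dexp mu (fun a => dexp (f a) g).
Proof.
rewrite /dexp /dbind; under eq_bigr do rewrite mulr_suml.
rewrite exchange_big /=; apply: eq_bigr => a _.
by rewrite mulr_sumr; apply: eq_bigr => b _; rewrite mulrA.
Qed.

Lemma dexp_dflip (a : R) (g : bool -> R) :
  dexp (dflip a) g = a * g true + (1 - a) * g false.
Proof. by rewrite /dexp big_bool. Qed.

Lemma eq_dexp (A : finType) (mu : dist R A) (f g : A -> R) :
  f =1 g -> dexp mu f = dexp mu g.
Proof. by move=> fg; apply: eq_bigr => a _; rewrite fg. Qed.

Lemma dprobE (A : finType) (mu : dist R A) (E : pred A) :
  dprob mu E = dexp mu (fun a => (E a)%:R).
Proof.
rewrite /dprob /dexp big_mkcond; apply: eq_bigr => a _.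
by case: (E a); rewrite ?mulr1 ?mulr0.
Qed.

Lemma conv_ge0 (a b c : R) :
  0 <= a <= 1 -> 0 <= b -> 0 <= c -> 0 <= a * b + (1 - a) * c.
Proof. by move=> /andP[a0 a1] b0 c0; rewrite addr_ge0 ?mulr_ge0 ?subr_ge0. Qed.

Lemma conv_le1 (a b c : R) :
  0 <= a <= 1 -> b <= 1 -> c <= 1 -> a * b + (1 - a) * c <= 1.
Proof. by move=> /andP[a0 a1] b1 c1; nra. Qed.

Lemma conv01 (a b c : R) : 0 <= a <= 1 -> 0 <= b <= 1 -> 0 <= c <= 1 ->
  0 <= a * b + (1 - a) * c <= 1.
Proof.
by move=> a01 /andP[b0 b1] /andP[c0 c1]; rewrite conv_ge0 ?conv_le1.
Qed.

Lemma expRN_le_chord (y : R) :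
  0 <= y <= 1 -> expR (- y) <= 1 - (1 - (expR 1)^-1) * y.
Proof.
move=> /andP[y0 y1]; have := convex_expR (Itv01 y0 y1) (-1) 0.
by rewrite !convRE /= /unstable.onem !mulr0 !addr0 mulrN1 expR0 !expRN; lra.
Qed.

End Expectation.

Section Sampling.
Variables (R : realType) (U V : finType) (T : nat) (I : instance R U V T).

Lemma hazard01 v j : 0 <= hazard I v j <= 1.
Proof.
have fin A : patience I v A \is a fin_num by exact: fin_num_measure.
have le_tail : fine (patience I v [set j]%classic) <=
    fine (patience I v [set k | (j <= k)%N]%classic).
  by rewrite fine_le //; apply: le_measure; rewrite ?inE // => k /= ->.
rewrite /hazard divr_ge0 ?fine_ge0 //=.
have [->|tail0] := eqVneq (fine (patience I v [set k | (j <= k)%N]%classic)) 0.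
  by rewrite invr0 mulr0 ler01.
by rewrite ler_pdivrMr ?mul1r // lt0r tail0 fine_ge0.
Qed.

Lemma dexp_matched_weight (mu : dist R {set U}) :
  dexp mu (matched_weight I) =
  \sum_u weight I u * dexp mu (fun M : {set U} => (u \in M)%:R).
Proof.
rewrite /dexp /matched_weight; under [RHS]eq_bigr do rewrite mulr_sumr.
rewrite exchange_big; apply: eq_bigr => M _.
rewrite big_mkcond mulr_sumr; apply: eq_bigr => u _.
by case: (u \in M); rewrite ?mulr1 ?mulr0 // mulrC.
Qed.

Definition serve_match v j (s : seq U) (u : U) : R :=
  dexp (serve I v j s finset.set0) (fun M : {set U} => (u \in M)%:R).

Lemma policy_matchE u v (s : policy U) :
  policy_match I u v s = serve_match v 1 (val (val s)) u.
Proof. exact: dprobE. Qed.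

Lemma serve_match_nil v j u : serve_match v j [::] u = 0.
Proof. by rewrite /serve_match /= dexp_dret inE. Qed.

Lemma serve_match_cons v j a s u : serve_match v j (a :: s) u =
  prob_edge I a v * (a == u)%:R +
  (1 - prob_edge I a v) * ((1 - hazard I v j) * serve_match v j.+1 s u).
Proof.
rewrite /serve_match /= dexp_dbind dexp_dflip dexp_dret dexp_dbind dexp_dflip.
by rewrite dexp_dret !inE orbF mulr0 add0r eq_sym.
Qed.

Lemma serve_match01 v j s u : 0 <= serve_match v j s u <= 1.
Proof.
elim: s j => [|a s IHs] j; first by rewrite serve_match_nil lexx ler01.
rewrite serve_match_cons; apply: conv01; first exact: prob_edge01.
  by case: eqP; rewrite lexx ler01.
have := conv01 (hazard01 v j) _ (IHs j.+1).
by move=> /(_ 0); rewrite mulr0 add0r; apply; rewrite lexx ler01.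
Qed.

(* Simulated probes make the chance of matching an unmatched [u] independent of
   the state of the other offline vertices. *)
Lemma serve_miss v j s u (M : {set U}) :
  dexp (serve I v j s M) (fun M' : {set U} => (u \notin M')%:R) =
  (u \notin M)%:R * (1 - serve_match v j s u).
Proof.
elim: s j M => [|a s IHs] j M.
  by rewrite serve_match_nil subr0 mulr1 /= dexp_dret.
rewrite serve_match_cons /= dexp_dbind dexp_dflip dexp_dret dexp_dbind.
rewrite dexp_dflip dexp_dret IHs.
have -> : (u \notin (if a \notin M then a |: M else M)) =
    (u \notin M) && (a != u).
  case: (boolP (a \in M)) => aM /=; last by rewrite !inE negb_or andbC eq_sym.
  by case: eqP => [<-|]; rewrite ?aM ?andbT.
by case: (u \in M); case: eqP => _ /=; ring.
Qed.

Lemma serve_mass v j s (M : {set U}) : dexp (serve I v j s M) (fun=> 1) = 1.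
Proof.
elim: s j M => [|a s IHs] j M; first by rewrite /= dexp_dret.
rewrite /= dexp_dbind dexp_dflip dexp_dret dexp_dbind dexp_dflip dexp_dret IHs.
by ring.
Qed.

Definition load (x : V -> policy U -> R) (u : U) : R :=
  \sum_v \sum_s x v s * policy_match I u v s.

Lemma LPP_valueE x : LPP_value I x = \sum_u weight I u * load x u.
Proof.
transitivity (\sum_u \sum_v \sum_s x v s * (policy_match I u v s * weight I u)).
  rewrite exchange_big; apply: eq_bigr => v _.
  by rewrite exchange_big; apply: eq_bigr => s _; rewrite mulr_sumr.
apply: eq_bigr => u _; rewrite mulr_sumr; apply: eq_bigr => v _.
by rewrite mulr_sumr; apply: eq_bigr => s _; ring.
Qed.

Lemma OPT_LPP_ge x : LPP_feasible I x -> LPP_value I x <= OPT_LPP I.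
Proof.
move=> fx; apply: ub_le_sup; last by exists x.
exists (\sum_u weight I u) => _ [y [yload _ _] <-].
rewrite LPP_valueE; apply: ler_sum => u _.
by rewrite -[leRHS]mulr1 ler_wpM2l ?weight_ge0 ?yload.
Qed.

Section Law.
Variables (x : V -> policy U -> R) (x_feasible : LPP_feasible I x).

Definition step_match (t : 'I_T) (u : U) : R :=
  \sum_v arrival I t v *
    \sum_s x v s / arrival_total I v * policy_match I u v s.

Lemma arrival_total_eq0 t v : arrival_total I v = 0 -> arrival I t v = 0.
Proof.
move=> /eqP; rewrite psumr_eq0 => [/allP/(_ t)|i _]; last exact: arrival_ge0.
by rewrite mem_index_enum => /(_ isT)/eqP.
Qed.

Lemma sample_mass t v :
  arrival I t v * \sum_s x v s / arrival_total I v = arrival I t v.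
Proof.
have [_ xsum _] := x_feasible.
have [/(arrival_total_eq0 t) ->|q0] := eqVneq (arrival_total I v) 0.
  by rewrite mul0r.
by rewrite -mulr_suml xsum divff ?mulr1.
Qed.

Lemma arrival_total_ge0 v : 0 <= arrival_total I v.
Proof. by apply: sumr_ge0 => t _; apply: arrival_ge0. Qed.

Lemma step_miss t u (M : {set U}) :
  dexp (sampling_step I x M t) (fun M' : {set U} => (u \notin M')%:R) =
  (u \notin M)%:R * (1 - step_match t u).
Proof.
have -> : 1 - step_match t u = \sum_v arrival I t v *
    \sum_s x v s / arrival_total I v * (1 - policy_match I u v s).
  rewrite -[in LHS](arrival_sum1 I t) -sumrB; apply: eq_bigr => v _.
  rewrite -{1}(sample_mass t v) -mulrBr -sumrB; congr (_ * _).
  by apply: eq_bigr => s _; ring.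
rewrite /sampling_step dexp_dbind mulr_sumr; apply: eq_bigr => v _.
rewrite dexp_dbind [RHS]mulrCA; congr (_ * _); rewrite mulr_sumr.
apply: eq_bigr => s _.
by rewrite /follow serve_miss policy_matchE mulrCA.
Qed.

Lemma step_mass t (M : {set U}) : dexp (sampling_step I x M t) (fun=> 1) = 1.
Proof.
rewrite /sampling_step dexp_dbind -[RHS](arrival_sum1 I t).
apply: eq_bigr => v _; rewrite -[RHS]sample_mass; congr (_ * _).
rewrite dexp_dbind; apply: eq_bigr => s _.
by rewrite /follow serve_mass mulr1.
Qed.

Lemma step_match_ge0 t u : 0 <= step_match t u.
Proof.
have [_ _ x0] := x_feasible.
apply: sumr_ge0 => v _; rewrite mulr_ge0 ?arrival_ge0 //.
apply: sumr_ge0 => s _; rewrite policy_matchE mulr_ge0 ?divr_ge0 //.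
  exact: arrival_total_ge0.
by have /andP[] := serve_match01 v 1 (val (val s)) u.
Qed.

Lemma step_match_le1 t u : step_match t u <= 1.
Proof.
have [_ _ x0] := x_feasible.
rewrite -(arrival_sum1 I t); apply: ler_sum => v _.
rewrite -[leRHS]sample_mass ler_wpM2l ?arrival_ge0 //.
apply: ler_sum => s _; rewrite -[leRHS]mulr1 ler_wpM2l //.
  by rewrite divr_ge0 ?arrival_total_ge0.
by rewrite policy_matchE; have /andP[] := serve_match01 v 1 (val (val s)) u.
Qed.

Lemma sum_step_match u : \sum_t step_match t u = load x u.
Proof.
have [_ xsum x0] := x_feasible.
rewrite exchange_big; apply: eq_bigr => v _ /=.
rewrite -mulr_suml -/(arrival_total I v) mulr_sumr; apply: eq_bigr => s _.
have [q0|q0] := eqVneq (arrival_total I v) 0; last by field.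
have /eqP := xsum v; rewrite q0 psumr_eq0 // => /allP/(_ s).
by rewrite mem_index_enum => /(_ isT)/eqP ->; rewrite !mul0r.
Qed.

Lemma sampling_law_miss u :
  dexp (sampling_law I x) (fun M : {set U} => (u \notin M)%:R) =
  \prod_t (1 - step_match t u).
Proof.
rewrite -big_enum /= /sampling_law.
elim/last_ind: (enum 'I_T) => [|ts t IHts].
  by rewrite big_nil dexp_dret inE.
rewrite foldl_rcons dexp_dbind (eq_dexp _ (step_miss t u)).
rewrite big_rcons /= -IHts /dexp mulr_suml; apply: eq_bigr => M _.
by rewrite mulrA.
Qed.

Lemma sampling_law_mass : dexp (sampling_law I x) (fun=> 1) = 1.
Proof.
rewrite /sampling_law; elim/last_ind: (enum 'I_T) => [|ts t IHts].
  by rewrite dexp_dret.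
by rewrite foldl_rcons dexp_dbind (eq_dexp _ (step_mass t)).
Qed.

Lemma sampling_law_match u : (1 - (expR 1)^-1) * load x u <=
  dexp (sampling_law I x) (fun M : {set U} => (u \in M)%:R).
Proof.
have [xload _ _] := x_feasible.
have -> : dexp (sampling_law I x) (fun M : {set U} => (u \in M)%:R) =
    1 - \prod_t (1 - step_match t u).
  apply/eqP; rewrite -sampling_law_miss eq_sym subr_eq; apply/eqP.
  rewrite -[LHS]sampling_law_mass.
  rewrite /dexp -big_split; apply: eq_bigr => M _ /=.
  by rewrite -mulrDr; case: (u \in M); rewrite /= ?addr0 ?add0r.
have l01 : 0 <= load x u <= 1.
  rewrite xload andbT -sum_step_match sumr_ge0 // => t _.
  exact: step_match_ge0.
have := expRN_le_chord l01.
suff: \prod_t (1 - step_match t u) <= expR (- load x u) by lra.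
rewrite -sum_step_match -sumrN expR_sum; apply: ler_prod => t _.
by rewrite subr_ge0 step_match_le1 expR_ge1Dx.
Qed.

Lemma sampling_weight_ge :
  (1 - (expR 1)^-1) * LPP_value I x <= sampling_weight I x.
Proof.
rewrite /sampling_weight dexp_matched_weight LPP_valueE mulr_sumr.
apply: ler_sum => u _; rewrite mulrCA ler_wpM2l ?weight_ge0 //.
exact: sampling_law_match.
Qed.

End Law.
End Sampling.

Section Offline.
Variables (R : realType) (U V : finType) (T : nat) (I : instance R U V T).

Section Types.
Variable tau : 'I_T -> V.

Definition failures (t : 'I_T) (F : {set 'I_T * U}) : {set U} :=
  [set u | (t, u) \in F]%SET.

(* Unlike [strategy_law], this remembers which arrival is matched to [u]. *)
Fixpoint hit (t : 'I_T) (u : U) (S : strategy R U T) (F : {set 'I_T * U}) : R :=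
  match S with
  | Stop => 0
  | Flip a S1 S2 => a * hit t u S1 F + (1 - a) * hit t u S2 F
  | Probe t' u' Ssucc Sfail Sexh =>
      let h := hazard I (tau t') #|failures t' F|.+1 in
      prob_edge I u' (tau t') *
        (((t' == t) && (u' == u))%:R + hit t u Ssucc F) +
      (1 - prob_edge I u' (tau t')) *
        (h * hit t u Sexh ((t', u') |: F) +
         (1 - h) * hit t u Sfail ((t', u') |: F))
  end.

Lemma hit_closed t u S M C F :
  admissible S M C F -> t \in C -> hit t u S F = 0.
Proof.
elim: S M C F => [|a S1 IH1 S2 IH2|t' u' Ss IHs Sf IHf Se IHe] M C F //=.
  by move=> /and3P[_ ad1 ad2] tC; rewrite (IH1 M C) ?(IH2 M C) // !mulr0 addr0.
move=> /and5P[_ t'C _ ads /andP[adf ade]] tC.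
have -> : (t' == t) = false by apply: contraNF t'C => /eqP ->.
rewrite (IHs _ _ _ ads) ?(IHf _ _ _ adf) ?(IHe _ _ _ ade) ?inE ?tC ?orbT //.
by rewrite !(addr0, mulr0).
Qed.

Lemma dexp_strategy_law01 u S M C F : admissible S M C F ->
  0 <= dexp (strategy_law I tau S M F) (fun M' : {set U} => (u \in M')%:R) <= 1.
Proof.
elim: S M C F => [|a S1 IH1 S2 IH2|t' u' Ss IHs Sf IHf Se IHe] M C F /=.
- by move=> _; rewrite dexp_dret ler0n lern1 leq_b1.
- move=> /and3P[a01 ad1 ad2]; rewrite dexp_dbind dexp_dflip.
  by apply: conv01; [|exact: IH1 ad1|exact: IH2 ad2].
move=> /and5P[_ _ _ ads /andP[adf ade]]; rewrite dexp_dbind dexp_dflip.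
apply: conv01; [exact: prob_edge01|exact: IHs ads|].
rewrite dexp_dbind dexp_dflip; apply: conv01; first exact: hazard01.
  exact: IHe ade.
exact: IHf adf.
Qed.

Lemma dexp_strategy_law u S M C F : admissible S M C F ->
  dexp (strategy_law I tau S M F) (fun M' : {set U} => (u \in M')%:R) =
  (u \in M)%:R + \sum_t hit t u S F.
Proof.
elim: S M C F => [|a S1 IH1 S2 IH2|t' u' Ss IHs Sf IHf Se IHe] M C F /=.
- by move=> _; rewrite dexp_dret big1 ?addr0.
- move=> /and3P[a01 ad1 ad2]; rewrite dexp_dbind dexp_dflip.
  rewrite (IH1 _ _ _ ad1) (IH2 _ _ _ ad2) big_split /= -!mulr_sumr.
  by ring.
move=> /and5P[u'M _ _ ads /andP[adf ade]]; rewrite dexp_dbind dexp_dflip.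
rewrite dexp_dbind dexp_dflip (IHs _ _ _ ads) (IHf _ _ _ adf) (IHe _ _ _ ade).
rewrite big_split /= -!mulr_sumr !big_split /= -!mulr_sumr.
have -> : \sum_t ((t' == t) && (u' == u))%:R = (u' == u)%:R :> R.
  rewrite (bigD1 t') //= eqxx big1 ?addr0 // => t /negPf.
  by rewrite eq_sym => ->.
have -> : (u \in (u' |: M)%SET)%:R = (u' == u)%:R + (u \in M)%:R :> R.
  rewrite !inE eq_sym; case: eqP => [<-|_]; first by rewrite (negPf u'M) addr0.
  by rewrite add0r.
by rewrite /failures; ring.
Qed.

(* [f] is the vector of matching probabilities of an arrival of type [v] whose
   attempts on [r] have failed and which goes on with a random policy
   extending [r]. *)
Definition policy_mixture (v : V) (r : seq U) (f : U -> R) : Prop :=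
  exists lam : policy U -> R,
    [/\ forall s, 0 <= lam s, \sum_s lam s = 1,
        forall s, lam s != 0 -> prefix r (val (val s))
      & forall u, f u =
          \sum_s lam s *
            serve_match I v (size r).+1 (drop (size r) (val (val s))) u].

Lemma policy_mixture_conv v r a (f g : U -> R) : 0 <= a <= 1 ->
  policy_mixture v r f -> policy_mixture v r g ->
  policy_mixture v r (fun u => a * f u + (1 - a) * g u).
Proof.
move=> a01 [lam [lam0 lam1 lamr lamE]] [mu [mu0 mu1 mur muE]].
exists (fun s => a * lam s + (1 - a) * mu s); split.
- by move=> s; apply: conv_ge0.
- by rewrite big_split /= -!mulr_sumr lam1 mu1; ring.
- move=> s; have [->|/lamr //] := eqVneq (lam s) 0.
  by have [->|/mur //] := eqVneq (mu s) 0; rewrite !mulr0 addr0 eqxx.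
- move=> u; rewrite lamE muE !mulr_sumr -big_split /=.
  by apply: eq_bigr => s _; ring.
Qed.

Lemma policy_mixture0 v (r : seq U) : uniq r -> policy_mixture v r (fun=> 0).
Proof.
move=> ur; have szr : (size r <= #|U|)%N by apply/card_geqP; exists r.
have urb : uniq (val (Bseq szr)) by [].
pose s0 : policy U := exist _ (Bseq szr) urb.
exists (fun s => (s == s0)%:R); split.
- by move=> s; rewrite ler0n.
- by rewrite (bigD1 s0) //= eqxx big1 ?addr0 // => s /negPf ->.
- move=> s; case: (eqVneq s s0) => [-> _|]; last by rewrite eqxx.
  by rewrite /= prefix_refl.
- move=> u; rewrite big1 // => s _; case: (eqVneq s s0) => [->|]; last first.
    by rewrite mul0r.
  by rewrite /= drop_size serve_match_nil mulr0.
Qed.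

Lemma policy_mixture_rcons v r a (f : U -> R) :
  policy_mixture v (rcons r a) f ->
  policy_mixture v r (fun u => prob_edge I a v * (a == u)%:R +
    (1 - prob_edge I a v) * ((1 - hazard I v (size r).+1) * f u)).
Proof.
move=> [lam [lam0 lam1 lamr lamE]]; exists lam; split=> // [s /lamr|u].
  exact/prefix_trans/prefix_rcons.
rewrite -[_ * (a == u)%:R]mul1r -{1}lam1 mulr_suml lamE.
rewrite !mulr_sumr -big_split /=.
apply: eq_bigr => s _; have [->|/lamr] := eqVneq (lam s) 0.
  by rewrite !mul0r !mulr0 addr0.
move=> /prefixP[s' ->]; rewrite drop_size_cat // cat_rcons drop_size_cat //.
by rewrite size_rcons serve_match_cons; ring.
Qed.

(* Until arrival [t] is matched, its only feedback is failure, so up to the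
   randomness coming from the other arrivals its probes follow a fixed order. *)
Lemma hit_policy_mixture t S M C F r :
  admissible S M C F -> t \notin C -> uniq r -> r =i failures t F ->
  policy_mixture (tau t) r (fun u => hit t u S F).
Proof.
elim: S M C F r => [|a S1 IH1 S2 IH2|t' u' Ss IHs Sf IHf Se IHe] M C F r /=.
- by move=> _ _ ur _; apply: policy_mixture0.
- move=> /and3P[a01 ad1 ad2] tC ur rF; apply: policy_mixture_conv => //.
    exact: IH1 ad1 _ _ _.
  exact: IH2 ad2 _ _ _.
move=> /and5P[_ _ t'u'F ads /andP[adf ade]] tC ur rF.
have [t't|t't] := eqVneq t' t; last first.
  have tC' : t \notin (t' |: C)%SET by rewrite !inE eq_sym negb_or t't.
  have rF' : r =i failures t ((t', u') |: F)%SET.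
    by move=> w; rewrite rF !inE xpair_eqE eq_sym (negPf t't).
  apply: policy_mixture_conv; first exact: prob_edge01.
    under eq_fun do rewrite /= add0r.
    exact: IHs ads _ _ _.
  apply: policy_mixture_conv; first exact: hazard01.
    exact: IHe ade _ _ _.
  exact: IHf adf _ _ _.
subst t'.
have u'r : u' \notin r by rewrite rF inE.
have := IHf _ _ _ (rcons r u') adf tC.
rewrite rcons_uniq u'r ur => /(_ isT).
have rF' : rcons r u' =i failures t ((t, u') |: F)%SET.
  by move=> w; rewrite mem_rcons !inE xpair_eqE eqxx /= rF inE.
move=> /(_ rF')/policy_mixture_rcons.
have -> : #|failures t F| = size r by rewrite -(card_uniqP ur); apply: eq_card.
congr policy_mixture; apply/funext => u /=.
rewrite (hit_closed _ ads) ?(hit_closed _ ade) ?inE ?eqxx //.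
by rewrite mulr0 !(addr0, add0r).
Qed.

End Types.

Definition types_law (tau : {ffun 'I_T -> V}) : R :=
  \prod_t arrival I t (tau t).

Lemma types_law_ge0 tau : 0 <= types_law tau.
Proof. by apply: prodr_ge0 => t _; apply: arrival_ge0. Qed.

Lemma types_law_mass : \sum_tau types_law tau = 1.
Proof.
rewrite -(bigA_distr_bigA (fun t v => arrival I t v)) big1 // => t _.
exact: arrival_sum1.
Qed.

Lemma types_law_marginal t v :
  \sum_tau types_law tau * (tau t == v)%:R = arrival I t v.
Proof.
pose P t' v' := arrival I t' v' * ((t' == t) ==> (v' == v))%:R.
transitivity (\prod_t' \sum_v' P t' v').
  rewrite bigA_distr_bigA; apply: eq_bigr => tau _.
  rewrite /types_law /P big_split /=; congr (_ * _).
  rewrite (bigD1 t) //= eqxx /= big1 ?mulr1 // => t' /negPf -> //.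
rewrite (bigD1 t) //= [X in _ * X]big1 ?mulr1 => [|t' /negPf tt'].
  rewrite (bigD1 v) //= /P !eqxx mulr1 big1 ?addr0 // => v' /negPf ->.
  by rewrite mulr0.
rewrite -(arrival_sum1 I t'); apply: eq_bigr => v' _.
by rewrite /P tt' mulr1.
Qed.

Lemma offline_weight_le_OPT (A : {ffun 'I_T -> V} -> strategy R U T) :
  offline_admissible A -> offline_weight I A <= OPT_LPP I.
Proof.
move=> adA.
have mix (tau : {ffun 'I_T -> V}) t : policy_mixture (tau t) [::]
    (fun u => hit tau t u (A tau) finset.set0).
  apply: hit_policy_mixture (adA tau) _ _ _; rewrite ?inE // => u.
  by rewrite !inE.
have [lam /(_ (_, _))/= lamP] :=
  boolp.choice (fun p : {ffun 'I_T -> V} * 'I_T => mix p.1 p.2).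
pose xA v s := \sum_tau types_law tau * \sum_t (tau t == v)%:R * lam (tau, t) s.
pose hits u (tau : {ffun 'I_T -> V}) := \sum_t hit tau t u (A tau) finset.set0.
have hitsE u (tau : {ffun 'I_T -> V}) :
    dexp (strategy_law I tau (A tau) finset.set0 finset.set0)
      (fun M : {set U} => (u \in M)%:R) = hits u tau.
  by rewrite (dexp_strategy_law tau u (adA tau)) inE add0r.
have loadE u : load I xA u = \sum_tau types_law tau * hits u tau.
  transitivity (\sum_v \sum_s \sum_tau \sum_t types_law tau *
      ((tau t == v)%:R * lam (tau, t) s * policy_match I u v s)).
    apply: eq_bigr => v _; apply: eq_bigr => s _.
    rewrite mulr_suml; apply: eq_bigr => tau _.
    by rewrite -mulrA mulr_suml mulr_sumr.
  under eq_bigr do rewrite exchange_big /=.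
  rewrite exchange_big; apply: eq_bigr => tau _ /=.
  under eq_bigr do rewrite exchange_big /=.
  rewrite exchange_big mulr_sumr; apply: eq_bigr => t _ /=.
  have [_ _ _ ->] := lamP tau t.
  rewrite (bigD1 (tau t)) //= [X in _ + X]big1 ?addr0 => [|v /negPf vt].
    rewrite mulr_sumr; apply: eq_bigr => s _.
    by rewrite eqxx mul1r drop0 policy_matchE.
  by apply: big1 => s _; rewrite eq_sym vt !mul0r mulr0.
have -> : offline_weight I A = LPP_value I xA.
  rewrite LPP_valueE /offline_weight.
  under [RHS]eq_bigr do rewrite loadE mulr_sumr.
  rewrite exchange_big; apply: eq_bigr => tau _ /=.
  rewrite dexp_matched_weight mulr_sumr; apply: eq_bigr => u _.
  by rewrite hitsE mulrCA.
apply: OPT_LPP_ge; split=> [u|v|v s].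
- rewrite -/(load I xA u) loadE -types_law_mass; apply: ler_sum => tau _.
  rewrite -[leRHS]mulr1 ler_wpM2l ?types_law_ge0 // -hitsE.
  by have /andP[] := dexp_strategy_law01 tau u (adA tau).
- transitivity (\sum_t \sum_tau types_law tau * (tau t == v)%:R); last first.
    by apply: eq_bigr => t _; apply: types_law_marginal.
  rewrite exchange_big [RHS]exchange_big; apply: eq_bigr => tau _ /=.
  rewrite -!mulr_sumr exchange_big; congr (_ * _); apply: eq_bigr => t _ /=.
  by rewrite -mulr_sumr; have [_ -> _ _] := lamP tau t; rewrite mulr1.
- apply: sumr_ge0 => tau _; rewrite mulr_ge0 ?types_law_ge0 //.
  apply: sumr_ge0 => t _.
  by rewrite mulr_ge0 ?ler0n //; have [-> _ _ _] := lamP tau t.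
Qed.

End Offline.

Theorem theorem6 (R : realType) (U V : finType) (T : nat)
    (I : instance R U V T) (kappa : R) (x : V -> policy U -> R)
    (kappa01 : 0 < kappa <= 1)
    (x_feasible : LPP_feasible I x)
    (x_value : kappa * OPT_LPP I <= LPP_value I x) :
  kappa * (1 - (expR 1)^-1) * OPT_LPP I <= sampling_weight I x /\
  competitive I (kappa * (1 - (expR 1)^-1)) (sampling_weight I x).
Proof.
have [kappa0 _] := andP kappa01.
have e0 : 0 <= 1 - (expR 1)^-1 :> R.
  by rewrite subr_ge0 invf_le1 ?expR_gt0 // -expR0 ler_expR.
have main : kappa * (1 - (expR 1)^-1) * OPT_LPP I <= sampling_weight I x.
  apply: le_trans (sampling_weight_ge x_feasible).
  by rewrite mulrAC mulrC ler_wpM2l.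
split=> // A adA; apply: le_trans main.
by rewrite ler_wpM2l ?offline_weight_le_OPT // mulr_ge0 // ltW.
Qed.
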